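(* For every natural number $n\geq 1$ with $n\neq 4$, the finite MV-chain $\mathbf{L}_{n+1}$ is term-equivalent to the algebra $\mathbf{L}^*_{n+1}$ if and only if $\mathbf{L}^*_{n+1}$ is strictly simple.
   Context: For $n\ge 1$ let $L_{n+1}=\{0,1/n,2/n,\ldots,(n-1)/n,1\}$. The $(n+1)$-element MV-chain is $\mathbf{L}_{n+1}=(L_{n+1},\Rightarrow,\neg,0,1)$ with $x\Rightarrow y=\min\{1,1-x+y\}$ (Łukasiewicz implication) and $\neg x=1-x$. The algebra $\mathbf{L}^*_{n+1}=(L_{n+1},\vee,*,\neg,0,1)$ has the same universe and the operations $x\vee y=\max\{x,y\}$, $*x=\max\{0,2x-1\}$ (the Łukasiewicz square), $\neg x=1-x$, and the constants $0,1$. Two algebras on the same universe are term-equivalent if every basic operation of each is a term operation of the other (equivalently here: $\Rightarrow$ is definable by a term in $\mathbf{L}^*_{n+1}$). $\mathbf{L}^*_{n+1}$ is strictly simple if it has no proper subalgebra other than the two-element one with universe $\{0,1\}$ (which is regarded as trivial). *)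

(* Defs.v *)
From HB Require Import structures.
From mathcomp Require Import all_boot all_order all_algebra.
From mathcomp Require Import ring lra zify.
Set Implicit Arguments.
Unset Strict Implicit.
Unset Printing Implicit Defensive.
Import Order.TTheory GRing.Theory Num.Theory.
Local Open Scope ring_scope.

Record signature := Signature { op : Type; arity : op -> nat }.

Definition algebra (s : signature) (A : Type) : Type :=
  forall o : op s, ('I_(arity o) -> A) -> A.

Inductive term (s : signature) (k : nat) : Type :=
| Var of 'I_k
| App (o : op s) of 'I_(arity o) -> term s k.

Fixpoint eval (s : signature) (A : Type) (X : algebra s A) (k : nat)
    (t : term s k) (e : 'I_k -> A) : A :=
  match t with
  | Var i => e i
  | App o ts => X o (fun j => eval X (ts j) e)
  end.

Definition term_operation (s : signature) (A : Type) (X : algebra s A)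
    (k : nat) (f : ('I_k -> A) -> A) : Prop :=
  exists t : term s k, forall e : 'I_k -> A, eval X t e = f e.

Definition term_equivalent (s1 s2 : signature) (A : Type)
    (X : algebra s1 A) (Y : algebra s2 A) : Prop :=
  (forall o : op s1, term_operation Y (X o)) /\
  (forall o : op s2, term_operation X (Y o)).

Definition subuniverse (s : signature) (A : finType) (X : algebra s A)
    (S : {set A}) : Prop :=
  forall (o : op s) (a : 'I_(arity o) -> A),
    (forall i, a i \in S) -> X o a \in S.

Definition Lseq (n : nat) : seq rat := [seq k%:R / n%:R | k <- iota 0 n.+1].

Definition L (n : nat) : finType := seq_sub (Lseq n).

Lemma LseqP (n : nat) (x : rat) :
  reflect (exists2 k, (k <= n)%N & x = k%:R / n%:R) (x \in Lseq n).
Proof.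
apply: (iffP mapP) => -[k hk ->]; exists k => //.
  by move: hk; rewrite mem_iota add0n ltnS.
by rewrite mem_iota add0n ltnS.
Qed.

Section Operations.
Variables (n : nat) (n_gt0 : (0 < n)%N).

Lemma Lseq_bounds (x : rat) : x \in Lseq n -> 0 <= x <= 1.
Proof.
have n0 : 0 < n%:R :> rat by rewrite ltr0n.
case/LseqP=> k hk ->; rewrite divr_ge0 ?ler0n //=.
by rewrite ler_pdivrMr // mul1r ler_nat.
Qed.

(* L_(n+1) consists of the integer multiples of 1/n lying in [0, 1]. *)
Lemma Lseq_int (x : rat) (z : int) :
  0 <= x <= 1 -> x = z%:~R / n%:R -> x \in Lseq n.
Proof.
have n0 : 0 < n%:R :> rat by rewrite ltr0n.
move=> /andP[x0 x1] xE; move: x0 x1; rewrite {}xE.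
rewrite pmulr_lge0 ?invr_gt0 // ler0z ler_pdivrMr // mul1r.
case: z => // k _; rewrite -pmulrn ler_nat => kn.
by apply/LseqP; exists k.
Qed.

Lemma n_neq0 : n%:R != 0 :> rat.
Proof. by rewrite pnatr_eq0 -lt0n. Qed.

Lemma Lseq0 : 0 \in Lseq n.
Proof. by apply: (@Lseq_int 0 0); rewrite ?mul0r ?lexx ?ler01. Qed.

Lemma Lseq1 : 1 \in Lseq n.
Proof.
by apply: (@Lseq_int 1 n%:Z); rewrite ?lexx ?ler01 // -pmulrn divff ?n_neq0.
Qed.

Lemma Lseq_neg (x : rat) : x \in Lseq n -> 1 - x \in Lseq n.
Proof.
move=> xL; have b := Lseq_bounds xL; case/LseqP: xL => k _ xE.
apply: (@Lseq_int _ (n%:Z - k%:Z)); first lra.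
by rewrite xE rmorphB /= -!pmulrn mulrBl divff ?n_neq0.
Qed.

Lemma Lseq_max (x y : rat) :
  x \in Lseq n -> y \in Lseq n -> Num.max x y \in Lseq n.
Proof. by move=> xL yL; case: leP. Qed.

Lemma Lseq_imp (x y : rat) :
  x \in Lseq n -> y \in Lseq n -> Num.min 1 (1 - x + y) \in Lseq n.
Proof.
move=> xL yL; case: leP => [_|lt1]; first exact: Lseq1.
have bx := Lseq_bounds xL; have := Lseq_bounds yL.
case/LseqP: xL => k _ xE; case/LseqP: yL => l _ yE by_.
apply: (@Lseq_int _ (n%:Z - k%:Z + l%:Z)); first lra.
by rewrite xE yE rmorphD rmorphB /= -!pmulrn mulrDl mulrBl divff ?n_neq0.
Qed.

Lemma Lseq_star (x : rat) : x \in Lseq n -> Num.max 0 (2 * x - 1) \in Lseq n.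
Proof.
move=> xL; case: leP => [ge0|_]; last exact: Lseq0.
have b := Lseq_bounds xL; case/LseqP: xL => k _ xE.
apply: (@Lseq_int _ (2 * k%:Z - n%:Z)); first lra.
by rewrite xE rmorphB rmorphM /= -!pmulrn mulrBl divff ?n_neq0 // mulrA.
Qed.

Definition L0 : L n := SeqSub Lseq0.
Definition L1 : L n := SeqSub Lseq1.
Definition Lneg (x : L n) : L n := SeqSub (Lseq_neg (valP x)).
Definition Lmax (x y : L n) : L n := SeqSub (Lseq_max (valP x) (valP y)).
Definition Limp (x y : L n) : L n := SeqSub (Lseq_imp (valP x) (valP y)).
Definition Lstar (x : L n) : L n := SeqSub (Lseq_star (valP x)).

End Operations.

Inductive mv_op := MVimp | MVneg | MVzero | MVone.

Definition mv_sig : signature :=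
  Signature (fun o => match o with
                      | MVimp => 2 | MVneg => 1 | MVzero | MVone => 0
                      end%N).

Definition mv_chain (n : nat) (n_gt0 : (0 < n)%N) : algebra mv_sig (L n) :=
  fun o => match o return ('I_(arity (s := mv_sig) o) -> L n) -> L n with
           | MVimp => fun a => Limp n_gt0 (a ord0) (a ord_max)
           | MVneg => fun a => Lneg n_gt0 (a ord0)
           | MVzero => fun=> L0 n_gt0
           | MVone => fun=> L1 n_gt0
           end.

Inductive star_op := STjoin | STstar | STneg | STzero | STone.

Definition star_sig : signature :=
  Signature (fun o => match o with
                      | STjoin => 2 | STstar | STneg => 1 | STzero | STone => 0
                      end%N).

Definition star_chain (n : nat) (n_gt0 : (0 < n)%N) : algebra star_sig (L n) :=
  fun o => match o return ('I_(arity (s := star_sig) o) -> L n) -> L n with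
           | STjoin => fun a => Lmax (a ord0) (a ord_max)
           | STstar => fun a => Lstar n_gt0 (a ord0)
           | STneg => fun a => Lneg n_gt0 (a ord0)
           | STzero => fun=> L0 n_gt0
           | STone => fun=> L1 n_gt0
           end.

(* Subuniverses of the star chain contain 0 and 1, so no nonemptiness
   condition is needed; when n = 1 the condition holds vacuously. *)
Definition strictly_simple (n : nat) (n_gt0 : (0 < n)%N) : Prop :=
  forall S : {set L n}, subuniverse (star_chain n_gt0) S ->
    S \proper [set: L n] -> S = [set L0 n_gt0; L1 n_gt0].

(* Main.v *)
Require Import Defs.
From mathcomp Require Import all_boot all_order all_algebra.
From mathcomp Require Import boolp.
From mathcomp Require Import zify.

Set Implicit Arguments.
Unset Strict Implicit.
Import Order.TTheory GRing.Theory Num.Theory.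

(** The proof passes through a criterion that holds for every n: the two algebras are term-equivalent exactly when every subuniverse of the
    star chain is a subuniverse of the MV-chain ([term_equivalentP]).

    One direction is the general fact that term operations preserve
    subuniverses.  For the other, the star chain is quasi-primal: every
    function whose value at each tuple e lies in the subalgebra generated by e
    is a term operation ([interpolation]).  As the lattice operations are
    available, this reduces to producing terms that are 1 at one tuple and 0
    at another.  The star operation is the doubling map on the upper half of
    the chain and, conjugated by negation, on the lower half; so two distinct
    points move apart at doubling speed until they lie on opposite sides of
    1/2 ([separation]), where star sends one of them, and only that one, to 0.

    Given the criterion, strict simplicity implies term-equivalence because
    {0, 1} and the whole chain are subuniverses of the MV-chain.  Conversely,
    a subuniverse of the MV-chain consists of the multiples of d/n for some
    divisor d of n ([mv_subuniverse_multiples]), so strict simplicity follows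
    once n has no divisor d with 1 < d < n.  A proper subuniverse of the star
    chain containing 1/n violates the criterion, since 1/n generates the whole
    MV-chain.  Such a subuniverse exists
    - if n has an odd divisor m with 1 < m < n: remove the multiples of m/n
      other than 0 and 1 ([odd_divisor]);
    - if n > 4 is a power of 2: keep the k/n for which k or n - k is a power
      of 2, which excludes 3/n ([two_power]).
    Hence n is 1, 2, 4 or an odd prime, and 4 is excluded by assumption. *)

(** * Terms and subuniverses of an arbitrary algebra *)

Lemma eval_subuniverse (s : signature) (A : finType) (X : algebra s A)
    (S : {set A}) (k : nat) (t : term s k) (e : 'I_k -> A) :
  subuniverse X S -> (forall i, e i \in S) -> eval X t e \in S.
Proof. by move=> subS eS; elim: t => [i|o ts IH] /=; [exact: eS | exact: subS]. Qed.

Lemma term_operation_subuniverse (s1 s2 : signature) (A : finType)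
    (X : algebra s1 A) (Y : algebra s2 A) (S : {set A}) :
  (forall o, term_operation Y (X o)) -> subuniverse Y S -> subuniverse X S.
Proof.
move=> XY subS o a aS; have [t <-] := XY o.
exact: eval_subuniverse.
Qed.

Definition generated (s : signature) (A : finType) (X : algebra s A) (k : nat)
    (e : 'I_k -> A) : {set A} :=
  [set c | `[< exists t : term s k, eval X t e = c >]].

Lemma generatedP (s : signature) (A : finType) (X : algebra s A) (k : nat)
    (e : 'I_k -> A) (c : A) :
  reflect (exists t, eval X t e = c) (c \in generated X e).
Proof. by rewrite inE; exact: asboolP. Qed.

Lemma generated_var (s : signature) (A : finType) (X : algebra s A) (k : nat)
    (e : 'I_k -> A) (i : 'I_k) : e i \in generated X e.
Proof. by apply/generatedP; exists (Var s i). Qed.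

(** Finitely many arguments, each the value of some term, can be assembled into
    one term; finiteness of the arity is what makes the choice possible. *)
Lemma subuniverse_generated (s : signature) (A : finType) (X : algebra s A)
    (k : nat) (e : 'I_k -> A) : subuniverse X (generated X e).
Proof.
move=> o a aG.
have /fin_all_exists[ts tsE] : forall i, exists t, eval X t e = a i.
  by move=> i; apply/generatedP.
apply/generatedP; exists (App ts) => /=; congr (X o _).
exact/funext.
Qed.

Lemma term_operation_var (s : signature) (A : Type) (X : algebra s A)
    (k : nat) (i : 'I_k) : term_operation X (fun e => e i).
Proof. by exists (Var s i). Qed.

Lemma term_operation_app (s : signature) (A : Type) (X : algebra s A)
    (k : nat) (o : op s) (g : 'I_(arity o) -> ('I_k -> A) -> A) :
  (forall i, term_operation X (g i)) ->
  term_operation X (fun e => X o (fun i => g i e)).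
Proof.
move=> /fin_all_exists[ts tsE]; exists (App ts) => e /=; congr (X o _).
by apply/funext => i; exact: tsE.
Qed.

Section Chain.

Variables (n : nat) (n_gt0 : (0 < n)%N).

Local Notation MV := (mv_chain n_gt0).
Local Notation ST := (star_chain n_gt0).
Local Notation zero := (L0 n_gt0).
Local Notation one := (L1 n_gt0).

(** * Numerators *)

(** An element of the chain is handled through its numerator: the enumeration
    0/n, 1/n, ..., n/n lists k/n at position k. *)
Definition num (x : L n) : nat := index (val x) (Lseq n).
Definition elt (k : nat) : L n := insubd zero (k%:R / n%:R : rat)%R.

Lemma num_frac_inj (j k : nat) : (j%:R / n%:R = k%:R / n%:R :> rat)%R -> j = k.
Proof.
move/(divIf (n_neq0 n_gt0)) => /eqP.
by rewrite eqr_nat => /eqP.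
Qed.

Lemma num_le (x : L n) : num x <= n.
Proof.
have : val x \in Lseq n by exact: valP.
by rewrite -index_mem size_map size_iota ltnS.
Qed.

Lemma val_num (x : L n) : (val x = (num x)%:R / n%:R)%R.
Proof.
have xL : val x \in Lseq n by exact: valP.
rewrite -{1}(nth_index 0%R xL) (nth_map 0) ?nth_iota //.
- by rewrite ltnS num_le.
- by rewrite size_iota ltnS num_le.
Qed.

Lemma num_eq (x : L n) (k : nat) : (val x = k%:R / n%:R)%R -> num x = k.
Proof. by rewrite val_num => /num_frac_inj. Qed.

Lemma num_inj : injective num.
Proof. by move=> x y xy; apply: val_inj; rewrite !val_num xy. Qed.

Lemma num_elt (k : nat) : k <= n -> num (elt k) = k.
Proof. by move=> kn; apply: num_eq; rewrite insubdK //; apply/LseqP; exists k. Qed.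

Lemma elt_num (x : L n) : elt (num x) = x.
Proof. by apply: num_inj; rewrite num_elt ?num_le. Qed.

Lemma num_zero : num zero = 0.
Proof. by apply: num_eq; rewrite mul0r. Qed.

Lemma num_one : num one = n.
Proof. by apply: num_eq; rewrite divff ?n_neq0. Qed.

Lemma num_neg (x : L n) : num (Lneg n_gt0 x) = n - num x.
Proof.
apply: num_eq; rewrite /= val_num natrB ?num_le // mulrBl divff ?n_neq0 //.
Qed.

Let frac_le (j k : nat) : (j%:R / n%:R <= k%:R / n%:R :> rat)%R = (j <= k).
Proof. by rewrite ler_pM2r ?ler_nat // invr_gt0 ltr0n. Qed.

Let one_frac : (1 = n%:R / n%:R :> rat)%R.
Proof. by rewrite divff ?n_neq0. Qed.

Lemma num_max (x y : L n) : num (Lmax x y) = maxn (num x) (num y).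
Proof.
apply: num_eq; rewrite /= !val_num.
rewrite /Order.max /= ltNge frac_le -ltnNge.
by case: (ltnP (num x) (num y)) => xy; congr (_%:R / _)%R; lia.
Qed.

Lemma num_star (x : L n) : num (Lstar n_gt0 x) = (num x).*2 - n.
Proof.
apply: num_eq; rewrite /= val_num mulrA -natrM [X in (_ - X)%R]one_frac mul2n.
case: (leqP n (num x).*2) => xn.
  by rewrite max_r; [rewrite natrB // mulrBl | rewrite subr_ge0 frac_le].
rewrite max_l; last by rewrite subr_le0 frac_le ltnW.
by rewrite (eqP (ltnW xn : _ - _ == 0)) mul0r.
Qed.

Lemma num_imp (x y : L n) : num (Limp n_gt0 x y) = minn n (n - num x + num y).
Proof.
apply: num_eq; rewrite /= !val_num [X in (X - _)%R]one_frac.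
rewrite [X in Order.min X]one_frac -mulrBl -mulrDl -natrB ?num_le // -natrD.
rewrite /Order.min /= ltNge frac_le -ltnNge.
by case: ltnP => ?; congr (_%:R / _)%R; lia.
Qed.

(** * Interpolation by terms of the star chain *)


Section Interpolation.

Variable k : nat.
Local Notation env := ('I_k -> L n).
Local Notation term_op := (@term_operation star_sig (L n) ST k).

Lemma term_op_neg (f : env -> L n) :
  term_op f -> term_op (fun e => Lneg n_gt0 (f e)).
Proof. by move=> hf; apply: (@term_operation_app _ _ ST k STneg (fun=> f)). Qed.

Lemma term_op_star (f : env -> L n) :
  term_op f -> term_op (fun e => Lstar n_gt0 (f e)).
Proof. by move=> hf; apply: (@term_operation_app _ _ ST k STstar (fun=> f)). Qed.

Lemma term_op_max (f g : env -> L n) :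
  term_op f -> term_op g -> term_op (fun e => Lmax (f e) (g e)).
Proof.
move=> hf hg.
by apply: (@term_operation_app _ _ ST k STjoin
  (fun i => if i == ord0 then f else g)) => i; case: ifP.
Qed.

Lemma term_op_zero : term_op (fun=> zero).
Proof.
by apply: (@term_operation_app _ _ ST k STzero (fun _ _ => zero)) => -[].
Qed.

Lemma term_op_one : term_op (fun=> one).
Proof.
by apply: (@term_operation_app _ _ ST k STone (fun _ _ => one)) => -[].
Qed.

Definition Lmin (x y : L n) : L n :=
  Lneg n_gt0 (Lmax (Lneg n_gt0 x) (Lneg n_gt0 y)).

Lemma num_min (x y : L n) : num (Lmin x y) = minn (num x) (num y).
Proof.
by rewrite num_neg num_max !num_neg; have := num_le x; have := num_le y; lia.
Qed.

Lemma term_op_min (f g : env -> L n) :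
  term_op f -> term_op g -> term_op (fun e => Lmin (f e) (g e)).
Proof. by move=> hf hg; apply/term_op_neg/term_op_max; apply: term_op_neg. Qed.

Lemma num_eq_one (c : L n) : num c = n <-> c = one.
Proof. by split=> [cn|->]; [apply: num_inj; rewrite num_one | exact: num_one]. Qed.

(** Two values below the middle, negated and starred, have their gap
    doubled; so do two values above the middle when starred.  The gap is at
    most n, so the values end up on opposite sides, where star (or its
    conjugate by negation) collapses exactly the one that must become 1 after
    negation. *)
Lemma separation (f : env -> L n) (e e' : env) : term_op f -> f e <> f e' ->
  exists2 g, term_op g & g e = one /\ g e' <> one.
Proof.
pose gap g := num (g e) - num (g e') + (num (g e') - num (g e)).
have [m] := ubnP (n - gap f); elim: m f => // m IH f.
rewrite ltnS => gap_f hf ff'; have ab : num (f e) <> num (f e') by move/num_inj.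
have an := num_le (f e); have bn := num_le (f e').
have [a_lo|a_hi] := leqP (num (f e)).*2 n;
  have [b_lo|b_hi] := leqP (num (f e')).*2 n.
- have hg := term_op_star (term_op_neg hf).
  apply: (IH _ _ hg) => [|/(congr1 num)]; rewrite /gap !num_star !num_neg.
    by move: gap_f; rewrite /gap; lia.
  by lia.
- exists (fun e => Lneg n_gt0 (Lstar n_gt0 (f e))).
    exact/term_op_neg/term_op_star.
  by rewrite -!num_eq_one !num_neg !num_star; lia.
- have [b_lt|b_gt|b_mid] := ltngtP (num (f e')).*2 n.
  + exists (fun e => Lneg n_gt0 (Lstar n_gt0 (Lneg n_gt0 (f e)))).
      exact/term_op_neg/term_op_star/term_op_neg.
    by rewrite -!num_eq_one !num_neg !num_star !num_neg; lia.
  + by lia.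
  + have hg := term_op_star hf.
    apply: (IH _ _ hg) => [|/(congr1 num)]; rewrite /gap !num_star.
      by move: gap_f; rewrite /gap; lia.
    by lia.
- have hg := term_op_star hf.
  apply: (IH _ _ hg) => [|/(congr1 num)]; rewrite /gap !num_star.
    by move: gap_f; rewrite /gap; lia.
  by lia.
Qed.

(** Away from 1, each star moves at least one step down, so n of them reach
    0; the value 1 is fixed. *)
Lemma term_op_delta (f : env -> L n) : term_op f ->
  term_op (fun e => if f e == one then one else zero).
Proof.
move=> hf; pose D j e := iter j (Lstar n_gt0) (f e).
have hD j : term_op (D j) by elim: j => [//|j IH]; exact: term_op_star.
have D_S j e : D j.+1 e = Lstar n_gt0 (D j e) by [].
have D_one j e : num (f e) = n -> num (D j e) = n.
  by move=> fn; elim: j => [//|j IH]; rewrite D_S num_star IH; lia.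
have D_small j e : num (f e) <> n -> num (D j e) <= n - j.+1.
  move=> fn; have := num_le (f e).
  elim: j => [|j IH] fle; first by rewrite /D /=; lia.
  by rewrite D_S num_star; have := IH fle; lia.
have [t tE] := hD n; exists t => e; rewrite tE; apply: num_inj.
case: eqP => [/num_eq_one/(D_one n)->|ne]; first by rewrite num_one.
have /(D_small n) : num (f e) <> n by move/num_eq_one.
by rewrite num_zero; lia.
Qed.

(** Two distinct tuples differ in some coordinate, so projections feed
    [separation]; the indicator is the meet of the resulting 0-1 functions. *)
Lemma term_op_indicator (e0 : env) (s : seq {ffun 'I_k -> L n}) :
  exists2 g, term_op g & g e0 = one /\
    {in s, forall e : {ffun 'I_k -> L n}, e <> finfun e0 -> g e = zero}.
Proof.
elim: s => [|e s [g hg [g0 gs]]].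
  by exists (fun=> one) => //; exact: term_op_one.
have [->|e_neq] := eqVneq e (finfun e0).
  by exists g => //; split=> // e'; rewrite inE => /orP[/eqP->//|]; exact: gs.
have [i ei] : exists i, e0 i <> e i.
  apply: contrapT => none; case/eqP: e_neq; apply/ffunP => i; rewrite ffunE.
  by apply: contrapT => ei; apply: none; exists i => /esym.
have [h hh [h0 he]] := separation (term_operation_var ST i) ei.
exists (fun e => Lmin (g e) (if h e == one then one else zero)).
  exact/term_op_min/term_op_delta.
split=> [|e']; first by apply: num_inj; rewrite g0 h0 eqxx num_min minnn.
rewrite inE => /orP[/eqP-> _|e's ne']; apply: num_inj; rewrite num_min num_zero.
  by move/eqP: he => /negPf->; rewrite num_zero minn0.
by rewrite gs // num_zero min0n.
Qed.

(** The join, over all tuples e0, of the meet of the indicator of e0 with a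
    term taking the right value at e0. *)
Theorem interpolation (f : env -> L n) :
  (forall e, f e \in generated ST e) -> term_op f.
Proof.
move=> f_gen.
suff [g [t tg] gf] : exists2 g, term_op g &
    {in enum {ffun 'I_k -> L n}, forall e : {ffun 'I_k -> L n}, g e = f e}.
  exists t => e; rewrite tg.
  have <- : finfun e = e :> env by apply/funext => i; rewrite ffunE.
  by apply: gf; rewrite mem_enum.
suff [g hg [gf _]] : exists2 g, term_op g &
    {in enum {ffun 'I_k -> L n}, forall e : {ffun 'I_k -> L n}, g e = f e} /\
    (forall e : {ffun 'I_k -> L n}, e \notin enum {ffun 'I_k -> L n} -> g e = zero).
  by exists g.
(* The join is built along the list of tuples; being zero at the tuples not
   yet treated, it does not disturb the values joined in later. *)
elim: (enum _) => [|e0 s [g hg [gs g_out]]].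
  by exists (fun=> zero); [exact: term_op_zero | split].
have [chi hchi [chi1 chi0]] := term_op_indicator e0 (enum {ffun 'I_k -> L n}).
have /generatedP[t te0] := f_gen e0.
(* Restricting the indicator to finite functions turns its conditions into
   plain inequality with e0. *)
have {}chi0 (e : {ffun 'I_k -> L n}) : e != e0 -> chi e = zero.
  move=> /eqP ne; apply: chi0; rewrite ?mem_enum //.
  by move=> eE; apply: ne; rewrite eE; apply/ffunP => i; rewrite ffunE.
exists (fun e => Lmax (Lmin (chi e) (eval ST t e)) (g e)).
  by apply: term_op_max => //; apply: term_op_min => //; exists t.
have far (e : {ffun 'I_k -> L n}) : e != e0 ->
    Lmax (Lmin (chi e) (eval ST t e)) (g e) = g e.
  by move=> /chi0 ->; apply: num_inj; rewrite num_max num_min num_zero min0n max0n.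
split=> e; rewrite inE.
  have [-> _|ne /= es] := eqVneq e e0; last by rewrite far // gs.
  apply: num_inj; rewrite num_max num_min chi1 te0 num_one.
  rewrite (minn_idPr (num_le _)).
  have [/gs->|/g_out->] := boolP (e0 \in s); first by rewrite maxnn.
  by rewrite num_zero maxn0.
by rewrite negb_or => /andP[ne es]; rewrite far // g_out.
Qed.

End Interpolation.

(** * Term-equivalence through subuniverses *)

Lemma star_op_mv_term (o : op star_sig) : term_operation MV (@star_chain n n_gt0 o).
Proof.
pose neg k := @App mv_sig k MVneg; pose imp k := @App mv_sig k MVimp.
pose im k (t u : term mv_sig k) := imp k (fun i => if i == ord0 then t else u).
case: o => /=.
- (* x \/ y = (x => y) => y *)
  exists (im 2 (im 2 (Var _ ord0) (Var _ ord_max)) (Var _ ord_max)) => e.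
  apply: num_inj; rewrite /= num_max !num_imp.
  have := num_le (e ord0); have := num_le (e ord_max); lia.
- (* star x = ~ (x => ~ x) *)
  pose x := Var mv_sig (ord0 : 'I_1).
  exists (neg 1 (fun=> im 1 x (neg 1 (fun=> x)))) => e.
  apply: num_inj; rewrite /= num_star !num_neg !num_imp !num_neg.
  by have := num_le (e ord0); lia.
- by exists (neg 1 (fun=> Var _ ord0)).
- by exists (@App mv_sig 0 MVzero (fun i => Var _ i)).
- by exists (@App mv_sig 0 MVone (fun i => Var _ i)).
Qed.

Lemma term_equivalentP :
  term_equivalent MV ST <->
  (forall S : {set L n}, subuniverse ST S -> subuniverse MV S).
Proof.
split=> [[mvst _] S subS|sub]; first exact: term_operation_subuniverse mvst subS.
split; last exact: star_op_mv_term.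
move=> o; apply: interpolation => e.
by apply: (sub _ (@subuniverse_generated _ _ ST _ e)); exact: generated_var.
Qed.

(** * Subuniverses of the MV-chain *)

Section MVsub.

Variable S : {set L n}.
Hypothesis subS : subuniverse MV S.

Lemma mv_sub_zero : zero \in S.
Proof. by apply: (subS (o := MVzero) (a := fun=> zero)) => -[]. Qed.

Lemma mv_sub_one : one \in S.
Proof. by apply: (subS (o := MVone) (a := fun=> zero)) => -[]. Qed.

Lemma mv_sub_neg x : x \in S -> Lneg n_gt0 x \in S.
Proof. by move=> xS; apply: (subS (o := MVneg) (a := fun=> x)). Qed.

Lemma mv_sub_imp x y : x \in S -> y \in S -> Limp n_gt0 x y \in S.
Proof.
move=> xS yS.
apply: (subS (o := MVimp) (a := fun i => if i == ord0 then x else y)) => i.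
by case: ifP.
Qed.

Lemma mv_sub_add j k : j + k <= n -> elt j \in S -> elt k \in S -> elt (j + k) \in S.
Proof.
move=> jk jS kS.
have -> : elt (j + k) = Limp n_gt0 (Lneg n_gt0 (elt j)) (elt k).
  by apply: num_inj; rewrite num_imp num_neg !num_elt //; lia.
by apply: mv_sub_imp => //; exact: mv_sub_neg.
Qed.

Lemma mv_sub_sub j k : j <= n -> k <= n -> elt j \in S -> elt k \in S ->
  elt (j - k) \in S.
Proof.
move=> jn kn jS kS.
have -> : elt (j - k) = Lneg n_gt0 (Limp n_gt0 (elt j) (elt k)).
  by apply: num_inj; rewrite num_neg num_imp !num_elt //; lia.
by apply: mv_sub_neg; exact: mv_sub_imp.
Qed.

(** The least positive numerator d divides all the others: subtracting d
    repeatedly stays inside S, so remainders modulo d lie in S and must be 0.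
    Truncated addition then gives back all the multiples of d. *)
Lemma mv_subuniverse_multiples :
  exists2 d, d %| n & forall x, (x \in S) = (d %| num x).
Proof.
have elt0 : elt 0 \in S by rewrite -num_zero elt_num mv_sub_zero.
have eltn : elt n \in S by have := mv_sub_one; rewrite -(elt_num one) num_one.
have ex : exists j, [&& 0 < j, j <= n & elt j \in S].
  by exists n; rewrite n_gt0 leqnn eltn.
have [d /and3P[d_gt0 dn dS] d_min] := ex_minnP ex.
have div_num x : x \in S -> d %| num x.
  move=> xS; have xn := num_le x.
  have modS j : elt (num x - j * d) \in S.
    elim: j => [|j IH]; first by rewrite subn0 elt_num.
    have -> : num x - j.+1 * d = num x - j * d - d by lia.
    by apply: mv_sub_sub => //; lia.
  have rE : num x - num x %/ d * d = num x %% d by have := divn_eq (num x) d; lia.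
  have := modS (num x %/ d); rewrite rE /dvdn => rS.
  have rd := ltn_pmod (num x) d_gt0.
  rewrite -leqn0 leqNgt; apply/negP => r_gt0.
  by have := d_min (num x %% d); rewrite r_gt0 rS; lia.
exists d => [|x]; first by have := div_num one mv_sub_one; rewrite num_one.
apply/idP/idP => [/div_num //|/dvdnP[q xE]].
have : q * d <= n by rewrite -xE num_le.
rewrite -(elt_num x) xE => {xE}.
elim: q => [//|q IH]; rewrite mulSn => qn.
by apply: mv_sub_add => //; apply: IH; lia.
Qed.

End MVsub.

Lemma mv_subuniverse_full (S : {set L n}) :
  subuniverse MV S -> elt 1 \in S -> S = [set: L n].
Proof.
move=> subS; have [d _ dE] := mv_subuniverse_multiples subS.
rewrite dE num_elt // dvdn1 => /eqP d1.
by apply/setP => x; rewrite dE d1 dvd1n inE.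
Qed.

(** * Star-subuniverses that contain 1/n *)

(** Closure under join is automatic, since the chain is totally ordered. *)
Lemma star_subuniverse (p : pred nat) :
  p 0 -> (forall j, j <= n -> p j -> p (n - j) /\ p (j.*2 - n)) ->
  subuniverse ST [set x | p (num x)].
Proof.
move=> p0 p_cl.
have cl x : p (num x) -> p (n - num x) /\ p ((num x).*2 - n).
  exact/p_cl/num_le.
have [pn _] := p_cl 0 (leq0n n) p0; rewrite subn0 in pn.
case=> a aS; rewrite /= inE.
- rewrite num_max /maxn.
  by have := aS ord0; have := aS ord_max; rewrite !inE; case: ifP.
- by rewrite num_star; have := aS ord0; rewrite inE => /cl[].
- by rewrite num_neg; have := aS ord0; rewrite inE => /cl[].
- by rewrite num_zero.
- by rewrite num_one.
Qed.

Section StarSubMV.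

Hypothesis sub_mv : forall S : {set L n}, subuniverse ST S -> subuniverse MV S.

(** A set of numerators containing 1 and closed for the star chain must be
    everything, as 1/n generates the MV-chain; an explicit closed set that
    misses some j <= n then refutes [sub_mv]. *)
Lemma closed_full (p : pred nat) (j : nat) :
  p 0 -> (forall j, j <= n -> p j -> p (n - j) /\ p (j.*2 - n)) ->
  p 1 -> j <= n -> p j.
Proof.
move=> p0 p_cl p1 jn.
have subS := sub_mv (star_subuniverse p0 p_cl).
have /(mv_subuniverse_full subS) : elt 1 \in [set x | p (num x)].
  by rewrite inE num_elt.
by move/setP/(_ (elt j)); rewrite !inE num_elt.
Qed.

(** As m is odd and divides n, it divides 2j - n only if it divides j: star
    creates no new multiple of m, apart from 0.  Hence the multiples of m other
    than 0 and n can be removed without losing closure. *)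
Lemma odd_divisor (m : nat) : odd m -> 1 < m -> m %| n -> m = n.
Proof.
move=> m_odd m_gt1 mn.
have m_le : m <= n by exact: dvdn_leq.
have : (m %| m) ==> (m == 0) || (m == n).
  apply: (@closed_full (fun j => (m %| j) ==> (j == 0) || (j == n)) m) => //.
  - by rewrite eqxx implybT.
  - move=> j jn /implyP pj; split; apply/implyP.
      by rewrite dvdn_subr // => /pj; lia.
    have [jn2 _|jn2] := leqP j.*2 n; first by lia.
    rewrite dvdn_subl ?(ltnW jn2) // -mul2n Gauss_dvdr ?coprimen2 // => /pj; lia.
  - by rewrite dvdn1 gtn_eqF.
by rewrite dvdnn => /orP[|] /eqP //; lia.
Qed.

(** When n is a power of 2, star doubles the distance n - j to the top when
    j is above the middle, and sends a power of 2 below n to 0; so the j with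
    j or n - j a power of 2 are closed.  For n > 4 neither 3 nor the odd number
    n - 3 > 1 is a power of 2. *)
Lemma two_power : 2.-nat n -> n <= 4.
Proof.
move=> n2; rewrite leqNgt; apply/negP => n_gt4.
have nat2_le j : j < n -> 2.-nat j -> j.*2 <= n.
  move=> jn; move: n2 jn => /p_natP[b ->] lt /p_natP[a ja].
  by move: lt; rewrite ja ltn_exp2l // -mul2n -expnS leq_exp2l.
have nat2_odd j : 2.-nat j -> odd j -> j = 1.
  by case/p_natP=> [[|a]] -> //; rewrite oddX.
have n_even : ~~ odd n by apply/negP => /(nat2_odd _ n2); lia.
have : 2.-nat 3 || 2.-nat (n - 3).
  apply: (@closed_full (fun j => 2.-nat j || 2.-nat (n - j)) 3) => //; last by lia.
    by rewrite subn0 n2 orbT.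
  move=> j jn pj; split; first by rewrite subKn // orbC.
  have [jn2|jn2] := leqP j.*2 n.
    by rewrite (eqP (jn2 : _ - _ == 0)) subn0 n2 orbT.
  case/orP: pj => pj.
    have [jlt|jn_eq] := ltnP j n; first by have := nat2_le _ jlt pj; lia.
    have -> : j.*2 - n = n by lia.
    by rewrite n2.
  have -> : n - (j.*2 - n) = 2 * (n - j) by lia.
  by rewrite pnatM pj orbT.
by case/orP=> /nat2_odd; lia.
Qed.

Lemma divisor_trivial (d : nat) : n <> 4 -> d %| n -> d = 1 \/ d = n.
Proof.
move=> n_neq4 dn; have d_gt0 := dvdn_gt0 n_gt0 dn.
have [n_odd|n_even] := boolP (odd n).
  have [d1|d_gt1] := leqP d 1; [left; lia | right].
  by apply: odd_divisor => //; exact: dvdn_odd dn n_odd.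
suff n2 : n = 2 by move: dn; rewrite n2 => /(dvdn_leq (ltn0Sn 1)); lia.
have odd_part : odd n`_2^' by rewrite odd_2'nat part_pnat.
have part1 : n`_2^' = 1.
  have [|gt1] := leqP n`_2^' 1; first by have := part_gt0 2^' n; lia.
  by move: n_even; rewrite -(odd_divisor odd_part gt1 (dvdn_part _ _)) odd_part.
have n2 : 2.-nat n.
  by rewrite -(partnC 2 n_gt0) part1 muln1 part_pnat.
by have := two_power n2; lia.
Qed.

End StarSubMV.
End Chain.

(** * Strict simplicity *)

Theorem theorem3p14 (n : nat) (n_gt0 : (0 < n)%N) (n_neq4 : n <> 4%N) :
  term_equivalent (mv_chain n_gt0) (star_chain n_gt0) <-> strictly_simple n_gt0.
Proof.
split=> [/term_equivalentP sub_mv S subS|simple].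
  have [d dn dE] := mv_subuniverse_multiples (sub_mv _ subS).
  have [d1|d_n] := divisor_trivial sub_mv n_neq4 dn.
    have -> : S = setT by apply/setP => x; rewrite dE d1 dvd1n inE.
    by rewrite properxx.
  move=> _; apply/setP => x; rewrite dE d_n !inE -!(inj_eq (@num_inj n)).
  rewrite num_zero num_one; have := num_le x.
  rewrite leq_eqVlt => /orP[/eqP-> |xn]; first by rewrite dvdnn eqxx orbT.
  rewrite (ltn_eqF xn) orbF.
  have [->|x_gt0] := posnP (num x); first by rewrite dvdn0.
  by rewrite gtnNdvd // gtn_eqF.
apply/term_equivalentP => S subS.
have [/(simple S subS) ->|] := boolP (S \proper setT); last first.
  by rewrite properT negbK => /eqP-> o a _; rewrite inE.
case=> a aS /=; rewrite !inE.
- rewrite -!(inj_eq (@num_inj n)) num_imp num_zero num_one.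
  have := aS ord0; have := aS ord_max.
  by rewrite !inE -!(inj_eq (@num_inj n)) num_zero num_one; lia.
- have := aS ord0.
  by rewrite !inE -!(inj_eq (@num_inj n)) num_neg num_zero num_one; lia.
- by rewrite eqxx.
- by rewrite eqxx orbT.
Qed.
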